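(* Assume that there are positive constants $K_1,K_2$ such that, with $K=(K_1,K_2)$ and for $\alpha=1,2$, $$f_\alpha(x,y,t,\mathbf 0)\le0,\quad f_\alpha(x,y,t,K)\ge0,\quad (x,y,t)\in\overline Q_T,$$ $0\le g_\alpha\le K_\alpha$ on $\partial Q_T$ and $0\le\psi_\alpha\le K_\alpha$ on $\overline\omega$. Let, for $p\in\overline\Omega^h$ and $\alpha=1,2$, $$\widehat U_\alpha(p,t_m)=\begin{cases}\psi_\alpha(p),&m=0,\\ 0,&m\ge1,\end{cases}\qquad \widetilde U_\alpha(p,t_m)=\begin{cases}\psi_\alpha(p),&m=0,\\ K_\alpha,&m\ge1.\end{cases}$$ Then $\widehat U$ and $\widetilde U$ are ordered lower and upper solutions (nondecreasing case) of the scheme (NDS), and $$0\le\widehat U_\alpha(p,t_m)\le\widetilde U_\alpha(p,t_m),\qquad p\in\overline\Omega^h,\ \alpha=1,2,\ m\ge1.$$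
   Context: Data: $l_1,l_2,T>0$, $\omega=(0,l_1)\times(0,l_2)$, $Q_T=\omega\times(0,T]$, $\partial Q_T=\partial\omega\times(0,T]$; for $\alpha=1,2$: constants $\varepsilon_\alpha>0$, smooth functions $f_\alpha(x,y,t,u)$, $u=(u_1,u_2)$, $g_\alpha$ on $\partial Q_T$, $\psi_\alpha$ on $\overline\omega$, and smooth nonnegative $v_{\alpha,1},v_{\alpha,2}$ on $\overline Q_T$. Vector inequalities are componentwise. Mesh: $x_i=ih_x$ ($0\le i\le N_x$, $h_x=l_1/N_x$), $y_j=jh_y$ ($0\le j\le N_y$, $h_y=l_2/N_y$), $t_m=m\tau$ ($0\le m\le N_\tau$, $\tau=T/N_\tau$). $\overline\Omega^h$ is the set of all $p=(x_i,y_j)$, $\Omega^h$ the interior ones, $\partial\Omega^h=\overline\Omega^h\setminus\Omega^h$. ''$m\ge1$'' means $1\le m\le N_\tau$. Operator: $\mathcal L^h_\alpha U_\alpha=-\varepsilon_\alpha(D_x^2U_\alpha+D_y^2U_\alpha)+v_{\alpha,1}D_x^1U_\alpha+v_{\alpha,2}D_y^1U_\alpha$, with $D_x^2,D_y^2$ the standard second central differences and $D_x^1,D_y^1$ the backward differences. Scheme (NDS): for $\alpha=1,2$, $m\ge1$, $(\mathcal L^h_\alpha(p,t_m)+\tau^{-1})U_\alpha(p,t_m)+f_\alpha(p,t_m,U)-\tau^{-1}U_\alpha(p,t_{m-1})=0$ for $p\in\Omega^h$; $U(p,t_m)=g(p,t_m)$ for $p\in\partial\Omega^h$; $U(p,0)=\psi(p)$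 for $p\in\overline\Omega^h$. Ordered upper and lower solutions (nondecreasing case): $\widetilde U,\widehat U$ are such if, for all $m\ge1$ and $\alpha=1,2$: $\widetilde U\ge\widehat U$ on $\overline\Omega^h$; on $\Omega^h$, $(\mathcal L^h_\alpha+\tau^{-1})\widetilde U_\alpha(p,t_m)+f_\alpha(p,t_m,\widetilde U)-\tau^{-1}\widetilde U_\alpha(p,t_{m-1})\ge0$ and $(\mathcal L^h_\alpha+\tau^{-1})\widehat U_\alpha(p,t_m)+f_\alpha(p,t_m,\widehat U)-\tau^{-1}\widehat U_\alpha(p,t_{m-1})\le0$; $\widehat U\le g\le\widetilde U$ on $\partial\Omega^h$; and $\widehat U(p,0)\le\psi(p)\le\widetilde U(p,0)$ on $\overline\Omega^h$. *)

(* Defs.v *)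
From HB Require Import structures.
From mathcomp Require Import all_boot all_order all_algebra.
From mathcomp Require Import all_classical all_reals all_analysis.
Set Implicit Arguments.
Unset Strict Implicit.
Unset Printing Implicit Defensive.
Import Order.TTheory GRing.Theory Num.Theory.
Import numFieldNormedType.Exports.
Local Open Scope classical_set_scope.
Local Open Scope ring_scope.

(* Only used with finite-dimensional [V], where iterating over all directions
   [v] is the same as iterating over the partial derivatives.  As [U] is meant
   to be open, only the values of [G] on [U] matter. *)
Fixpoint Ck (R : realType) (V : normedModType R) (k : nat) (U : set V)
    (G : V -> R) : Prop :=
  (forall x, U x -> {for x, continuous G}) /\
  (if k is k'.+1 then
     forall v : V, (forall x, U x -> derivable G x v) /\ Ck k' U ('D_v G)
   else True).

(* [D] need not be open: [F] is smooth on [D] if near each point of [D] it is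
   the restriction to [D] of a C^oo function. *)
Definition smooth_on (R : realType) (V : normedModType R) (D : set V)
    (F : V -> R) : Prop :=
  forall x, D x -> exists (U : set V) (G : V -> R),
    [/\ open U, U x, forall k, Ck k U G & forall z, D z -> U z -> F z = G z].

Section Domain.
Context {R : realType}.

Definition omega (l1 l2 : R) : set (R * R) := `]0, l1[ `*` `]0, l2[.
Definition omega_bar (l1 l2 : R) : set (R * R) := closure (omega l1 l2).
Definition omega_bd (l1 l2 : R) : set (R * R) :=
  closure (omega l1 l2) `\` (omega l1 l2)°.

(* Space-time points are [(x, y, t)], i.e. [((x, y), t)]. *)
Definition QT (l1 l2 T : R) : set (R * R * R) := omega l1 l2 `*` `]0, T].
Definition QT_bar (l1 l2 T : R) : set (R * R * R) := closure (QT l1 l2 T).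
(* The lateral boundary, not the topological boundary of [QT]. *)
Definition QT_bd (l1 l2 T : R) : set (R * R * R) := omega_bd l1 l2 `*` `]0, T].

End Domain.

(* The index alpha = 1, 2 ranges over ['I_2]. *)
Record problem (R : realType) := Problem {
  l1 : R; l2 : R; Tfin : R;
  eps : 'I_2 -> R;
  v1 : 'I_2 -> R * R * R -> R;
  v2 : 'I_2 -> R * R * R -> R;
  f : 'I_2 -> R * R * R * 'rV[R]_2 -> R;
  g : 'I_2 -> R * R * R -> R;
  psi : 'I_2 -> R * R -> R;
  l1_gt0 : 0 < l1; l2_gt0 : 0 < l2; Tfin_gt0 : 0 < Tfin;
  eps_gt0 : forall a, 0 < eps a;
  v1_smooth : forall a, smooth_on (QT_bar l1 l2 Tfin) (v1 a);
  v2_smooth : forall a, smooth_on (QT_bar l1 l2 Tfin) (v2 a);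
  v1_ge0 : forall a z, QT_bar l1 l2 Tfin z -> 0 <= v1 a z;
  v2_ge0 : forall a z, QT_bar l1 l2 Tfin z -> 0 <= v2 a z;
  f_smooth : forall a, smooth_on (QT_bar l1 l2 Tfin `*` setT) (f a);
  g_smooth : forall a, smooth_on (QT_bd l1 l2 Tfin) (g a);
  psi_smooth : forall a, smooth_on (omega_bar l1 l2) (psi a) }.

Record mesh := Mesh {
  Nx : nat; Ny : nat; Nt : nat;
  Nx_gt0 : (0 < Nx)%N; Ny_gt0 : (0 < Ny)%N; Nt_gt0 : (0 < Nt)%N }.

Section Scheme.
Context {R : realType} (P : problem R) (M : mesh).

Definition hx : R := l1 P / (Nx M)%:R.
Definition hy : R := l2 P / (Ny M)%:R.
Definition tau : R := Tfin P / (Nt M)%:R.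

(* A mesh point (x_i, y_j) is represented by its index pair (i, j), and a mesh
   function by its values on the indices; values at indices outside the mesh
   are never used. *)
Definition pt (p : nat * nat) : R * R := (p.1%:R * hx, p.2%:R * hy).
Definition tm (m : nat) : R := m%:R * tau.

Definition Omega_bar (p : nat * nat) : Prop :=
  (p.1 <= Nx M)%N /\ (p.2 <= Ny M)%N.
Definition Omega (p : nat * nat) : Prop :=
  (0 < p.1 < Nx M)%N /\ (0 < p.2 < Ny M)%N.
Definition Omega_bd (p : nat * nat) : Prop := Omega_bar p /\ ~ Omega p.
Definition time_level (m : nat) : Prop := (1 <= m <= Nt M)%N.

(* To be evaluated at interior mesh points only, because of [.-1] on [nat]. *)
Definition Dx2 (W : nat * nat -> R) (p : nat * nat) : R :=
  (W (p.1.-1, p.2) - 2 * W p + W (p.1.+1, p.2)) / hx ^+ 2.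
Definition Dy2 (W : nat * nat -> R) (p : nat * nat) : R :=
  (W (p.1, p.2.-1) - 2 * W p + W (p.1, p.2.+1)) / hy ^+ 2.
Definition Dx1 (W : nat * nat -> R) (p : nat * nat) : R :=
  (W p - W (p.1.-1, p.2)) / hx.
Definition Dy1 (W : nat * nat -> R) (p : nat * nat) : R :=
  (W p - W (p.1, p.2.-1)) / hy.

Definition Lh (a : 'I_2) (m : nat) (W : nat * nat -> R) (p : nat * nat) : R :=
  - eps P a * (Dx2 W p + Dy2 W p)
  + v1 P a (pt p, tm m) * Dx1 W p + v2 P a (pt p, tm m) * Dy1 W p.

(* [U p m 0 a] is U_alpha(p, t_m). *)
Definition mesh_fun := nat * nat -> nat -> 'rV[R]_2.

Definition NDS_lhs (U : mesh_fun) (a : 'I_2) (p : nat * nat) (m : nat) : R :=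
  Lh a m (fun q => U q m 0 a) p + tau^-1 * U p m 0 a
  + f P a (pt p, tm m, U p m) - tau^-1 * U p m.-1 0 a.

Definition NDS_solution (U : mesh_fun) : Prop :=
  [/\ forall a p m, time_level m -> Omega p -> NDS_lhs U a p m = 0,
      forall a p m, time_level m -> Omega_bd p ->
        U p m 0 a = g P a (pt p, tm m)
    & forall a p, Omega_bar p -> U p 0%N 0 a = psi P a (pt p)].

(* [Ut] is the upper and [Uh] the lower solution (nondecreasing case). *)
Definition ordered_upper_lower (Ut Uh : mesh_fun) : Prop :=
  [/\ forall a p m, time_level m -> Omega_bar p -> Uh p m 0 a <= Ut p m 0 a,
      forall a p m, time_level m -> Omega p ->
        0 <= NDS_lhs Ut a p m /\ NDS_lhs Uh a p m <= 0,
      forall a p m, time_level m -> Omega_bd p ->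
        Uh p m 0 a <= g P a (pt p, tm m) <= Ut p m 0 a
    & forall a p, Omega_bar p ->
        Uh p 0%N 0 a <= psi P a (pt p) <= Ut p 0%N 0 a].

End Scheme.

(* Main.v *)
Require Import Defs.
From mathcomp Require Import all_boot all_order all_algebra.
From mathcomp Require Import all_classical all_reals all_analysis.
From mathcomp Require Import ring lra.

(** Why it holds: the difference operator annihilates constants, so for a mesh
function that is constant in space at time level [m] with value [k] the residual
of the scheme reduces to [f(p, t_m, k) + (k - U(p, t_{m-1})) / tau]
([NDS_lhs_const]).  With [k = 0] the assumption on [f(.,0)] bounds the first term
above by 0, with [k = K] the assumption on [f(.,K)] bounds it below by 0.  The
second term has the same sign, since at every time level both mesh functions
take values between 0 and [K] ([step_bounds]): it vanishes from the second step
on, and on the first one it is [- psi / tau] or [(K - psi) / tau].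

The bounds on the data are assumed on subsets of the continuous domain, defined
topologically, so the rest of the work is to place the mesh points there: a mesh
point lies in the closure of [omega] ([pt_omega_bar]), and a boundary mesh point
lies moreover outside [omega], hence outside its interior
([mesh_bd_QT_bd]). *)

Set Implicit Arguments.
Unset Strict Implicit.
Unset Printing Implicit Defensive.
Import Order.TTheory GRing.Theory Num.Theory.
Import numFieldNormedType.Exports.
Local Open Scope classical_set_scope.
Local Open Scope ring_scope.

(** * Closures of intervals and products *)

Lemma subset_closureX (S T : topologicalType) (A : set S) (B : set T) :
  closure A `*` closure B `<=` closure (A `*` B).
Proof.
move=> [x y] [/= Ax By] C [[U V] /= [Ux Vy] UVC].
have [x' [Ax' Ux']] := Ax _ Ux; have [y' [By' Vy']] := By _ Vy.
by exists (x', y'); split => //; apply: UVC.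
Qed.

(** Any [x] in the closed interval is the limit, as [s] decreases to 0, of the
points [x + s * (c - x)] of the segment joining it to the midpoint [c], which
are in the open interval for [0 < s < 1]. *)
Lemma subset_closure_itvoo (R : realType) (a b : R) :
  a < b -> `[a, b] `<=` closure `]a, b[.
Proof.
move=> ab x /=; rewrite in_itv /= => /andP[ax xb] B Bx.
pose c := (a + b) / 2.
have cvgx : x + s * (c - x) @[s --> 0^'+] --> x.
  rewrite -[X in _ --> X]addr0; rewrite -[X in _ --> _ + X](mul0r (c - x)).
  apply: cvgD; first exact: cvg_cst.
  by apply: cvgMr_tmp; apply: cvg_within.
have nB : \forall s \near 0^'+, B (x + s * (c - x)) by exact: cvgx.
near (0 : R)^'+ => s.
exists (x + s * (c - x)); split; last by near: s.
have s0 : 0 < s by near: s; exact: nbhs_right_gt.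
have s1 : s < 1 by near: s; exact: nbhs_right_lt.
have ac : a < c by rewrite /c; lra.
have cb : c < b by rewrite /c; lra.
rewrite /= in_itv /=; apply/andP; split; nra.
Unshelve. all: by end_near.
Qed.

(** * Position of the mesh points in the domain *)

Lemma node_gt0 (R : realType) (l : R) (N i : nat) :
  0 < l -> (0 < N)%N -> (0 < i%:R * (l / N%:R)) = (0 < i)%N.
Proof.
by move=> l0 N0; rewrite pmulr_lgt0 ?divr_gt0 ?ltr0n.
Qed.

Lemma node_le (R : realType) (l : R) (N i : nat) :
  0 < l -> (0 < N)%N -> (i%:R * (l / N%:R) <= l) = (i <= N)%N.
Proof.
move=> l0 N0; rewrite mulrCA ger_pMr // ler_pdivrMr ?ltr0n //.
by rewrite mul1r ler_nat.
Qed.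

Lemma node_lt (R : realType) (l : R) (N i : nat) :
  0 < l -> (0 < N)%N -> (i%:R * (l / N%:R) < l) = (i < N)%N.
Proof.
move=> l0 N0; rewrite mulrCA gtr_pMr // ltr_pdivrMr ?ltr0n //.
by rewrite mul1r ltr_nat.
Qed.

Lemma node_closure (R : realType) (l : R) (N i : nat) :
  0 < l -> (0 < N)%N -> (i <= N)%N -> closure `]0, l[ (i%:R * (l / N%:R)).
Proof.
move=> l0 N0 iN; apply: subset_closure_itvoo => //=.
by rewrite in_itv /= node_le // iN mulr_ge0 // divr_ge0 // ltW.
Qed.

Section MeshPoints.
Context {R : realType} (P : problem R) (M : mesh).

Lemma pt_omega_bar p : Omega_bar M p -> omega_bar (l1 P) (l2 P) (pt P M p).
Proof.
move=> [p1 p2]; apply: subset_closureX; split.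
  exact: node_closure (l1_gt0 P) (Nx_gt0 M) p1.
exact: node_closure (l2_gt0 P) (Ny_gt0 M) p2.
Qed.

Lemma tm_itv m : time_level M m -> tm P M m \in `]0, Tfin P].
Proof.
move=> /andP[m0 mN]; rewrite in_itv /= /tm /tau.
by rewrite node_gt0 ?node_le ?m0 ?(Tfin_gt0 P) ?(Nt_gt0 M).
Qed.

Lemma mesh_QT_bar p m : Omega_bar M p -> time_level M m ->
  QT_bar (l1 P) (l2 P) (Tfin P) (pt P M p, tm P M m).
Proof.
move=> Mp Mm; apply: subset_closureX; split; first exact: pt_omega_bar.
exact/subset_closure/tm_itv.
Qed.

(** The topological boundary removes only the interior of [omega], which is
contained in [omega]; so it is enough that the point is not in [omega]. *)
Lemma mesh_bd_QT_bd p m : Omega_bd M p -> time_level M m ->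
  QT_bd (l1 P) (l2 P) (Tfin P) (pt P M p, tm P M m).
Proof.
move=> [Mp NMp] Mm; split; last exact: tm_itv.
split; first exact: pt_omega_bar.
move=> /interior_subset [/=]; rewrite !in_itv /= /hx /hy.
rewrite !node_gt0 ?node_lt ?(l1_gt0 P) ?(l2_gt0 P) ?(Nx_gt0 M) ?(Ny_gt0 M) //.
by move=> p1 p2; apply: NMp.
Qed.

(** * The scheme on spatially constant mesh functions *)

Lemma Omega_sub_bar p : Omega M p -> Omega_bar M p.
Proof. by move=> [/andP[_ /ltnW p1] /andP[_ /ltnW p2]]. Qed.

Lemma Lh_const a m (W : nat * nat -> R) (c : R) p :
  (forall q, Omega_bar M q -> W q = c) -> Omega M p -> Lh P M a m W p = 0.
Proof.
move=> Wc Mp; have [p1 p2] := Omega_sub_bar Mp.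
have [/andP[_ p1N] /andP[_ p2N]] := Mp.
have W0 : W p = c by apply: Wc.
have Wl : W (p.1.-1, p.2) = c.
  by apply: Wc; split => //=; apply: leq_trans (leq_pred _) _.
have Wr : W (p.1.+1, p.2) = c by apply: Wc.
have Wd : W (p.1, p.2.-1) = c.
  by apply: Wc; split => //=; apply: leq_trans (leq_pred _) _.
have Wu : W (p.1, p.2.+1) = c by apply: Wc.
rewrite /Lh /Dx2 /Dy2 /Dx1 /Dy1 W0 Wl Wr Wd Wu; ring.
Qed.

Lemma NDS_lhs_const (U : mesh_fun) (k : 'rV[R]_2) a p m :
  (forall b q, Omega_bar M q -> U q m 0 b = k 0 b) -> Omega M p ->
  NDS_lhs P M U a p m =
  f P a (pt P M p, tm P M m, k) + (tau P M)^-1 * (k 0 a - U p m.-1 0 a).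
Proof.
move=> Uk Mp; have Mp' := Omega_sub_bar Mp.
have -> : k = U p m by apply/rowP => b; rewrite Uk.
rewrite /NDS_lhs (Lh_const a m (Uk a) Mp); ring.
Qed.

(** Used for the level preceding the current one.  Level 0 is the only one at
which the mesh function need not be constant in space; bounding it together with
the others makes the first step no different from the later ones. *)
Lemma step_bounds (U : mesh_fun) (k K : 'rV[R]_2) a p m :
  (forall z, omega_bar (l1 P) (l2 P) z -> 0 <= psi P a z <= K 0 a) ->
  (forall q, Omega_bar M q -> U q 0%N 0 a = psi P a (pt P M q)) ->
  (forall q n, Omega_bar M q -> time_level M n -> U q n 0 a = k 0 a) ->
  0 <= k 0 a <= K 0 a ->
  Omega_bar M p -> (m <= Nt M)%N -> 0 <= U p m 0 a <= K 0 a.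
Proof.
move=> psiK U0 Uk kK Mp; case: m => [|m] mN.
  by rewrite U0 //; exact/psiK/pt_omega_bar.
by rewrite Uk.
Qed.

End MeshPoints.

Theorem theorem8 (R : realType) (P : problem R) (M : mesh) (K : 'rV[R]_2)
    (Kpos : forall a, 0 < K 0 a)
    (f_zero : forall a z, QT_bar (l1 P) (l2 P) (Tfin P) z -> f P a (z, 0) <= 0)
    (f_K : forall a z, QT_bar (l1 P) (l2 P) (Tfin P) z -> 0 <= f P a (z, K))
    (g_bounds : forall a z, QT_bd (l1 P) (l2 P) (Tfin P) z -> 0 <= g P a z <= K 0 a)
    (psi_bounds : forall a z,
      omega_bar (l1 P) (l2 P) z -> 0 <= psi P a z <= K 0 a)
    (Uh Ut : @mesh_fun R)
    (Uh_init : forall a p, Omega_bar M p -> Uh p 0%N 0 a = psi P a (pt P M p))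
    (Uh_pos : forall a p m,
      Omega_bar M p -> time_level M m -> Uh p m 0 a = 0)
    (Ut_init : forall a p, Omega_bar M p -> Ut p 0%N 0 a = psi P a (pt P M p))
    (Ut_pos : forall a p m,
      Omega_bar M p -> time_level M m -> Ut p m 0 a = K 0 a) :
  ordered_upper_lower P M Ut Uh /\
  (forall a p m, Omega_bar M p -> time_level M m ->
     0 <= Uh p m 0 a <= Ut p m 0 a).
Proof.
have K0 a : 0 <= (0 : 'rV[R]_2) 0 a <= K 0 a by rewrite mxE lexx ltW.
have KK a : 0 <= K 0 a <= K 0 a by rewrite lexx ltW.
have Uh0 a p m : Omega_bar M p -> time_level M m ->
    Uh p m 0 a = (0 : 'rV[R]_2) 0 a by move=> *; rewrite mxE Uh_pos.
have tau_ge0 : 0 <= (tau P M)^-1.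
  by rewrite invr_ge0 divr_ge0 // ltW // Tfin_gt0.
split; first split.
- by move=> a p m Mm Mp; rewrite Uh_pos // Ut_pos // ltW.
- move=> a p m Mm Mp; have Mp' := Omega_sub_bar Mp.
  have Qz := mesh_QT_bar (P := P) Mp' Mm.
  have mN : (m.-1 <= Nt M)%N.
    by case/andP: Mm => _; apply: leq_trans (leq_pred _).
  rewrite (NDS_lhs_const P a (fun b q Mq => Ut_pos b q m Mq Mm) Mp).
  rewrite (NDS_lhs_const P a (fun b q Mq => Uh0 b q m Mq Mm) Mp).
  have /andP[_ UtK] := step_bounds (psi_bounds a) (Ut_init a)
    (Ut_pos a) (KK a) Mp' mN.
  have /andP[Uh_ge0 _] := step_bounds (psi_bounds a) (Uh_init a)
    (Uh0 a) (K0 a) Mp' mN.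
  split; first by rewrite addr_ge0 ?f_K // mulr_ge0 // subr_ge0.
  by rewrite -oppr_ge0 opprD addr_ge0 ?oppr_ge0 ?f_zero // mulr_ge0_le0 //
    mxE sub0r oppr_le0.
- move=> a p m Mm Mp; have [Mp' _] := Mp.
  by rewrite Uh_pos // Ut_pos //; exact/g_bounds/mesh_bd_QT_bd.
- by move=> a p Mp; rewrite Uh_init // Ut_init // lexx.
- by move=> a p m Mp Mm; rewrite Uh_pos // Ut_pos // lexx ltW.
Qed.
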